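(* Let $p$ be an odd prime and let $d\in\mathbb{Z}$ with $\left(\frac{-d}{p}\right)=-1$. For an integer $m\ge 0$ put $S_m(d,p)=\det\left[(j^2+dk^2)^m\right]_{1\le j,k\le (p-1)/2}$. (i) We have $\left(\frac{S_{p-2}(d,p)}{p}\right)=\left(\frac 2p\right)$. Moreover, $$\det\left[\frac1{j^2+dk^2}\right]_{1\le j,k\le (p-1)/2}\equiv\begin{cases}d^{(p-1)/4}\pmod p&\text{if } p\equiv1\pmod4,\\(-1)^{(p+1)/4}\pmod p&\text{if } p\equiv3\pmod4.\end{cases}$$ (ii) We have $\left(\frac{S_{p-3}(d,p)}{p}\right)=\frac{1-\left(\frac{-1}{p}\right)}{2}$. Moreover, when $p\equiv3\pmod4$, $$\det\left[\frac1{(j^2+dk^2)^2}\right]_{1\le j,k\le (p-1)/2}\equiv\frac14\prod_{r=1}^{(p-3)/4}\left(r+\frac14\right)^2\pmod p.$$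
   Context: $\left(\frac{\cdot}{p}\right)$ is the Legendre symbol. Since $\left(\frac{-d}{p}\right)=-1$, no $j^2+dk^2$ with $1\le j,k\le(p-1)/2$ is divisible by $p$, so the determinants above are rational numbers whose denominators are prime to $p$; congruences modulo $p$ between such rationals are understood in the ring of rationals with denominator prime to $p$. *)

(* Defs.v *)
From mathcomp Require Import all_boot all_order all_algebra.
Set Implicit Arguments. Unset Strict Implicit. Unset Printing Implicit Defensive.
Import Order.TTheory GRing.Theory Num.Theory.
Local Open Scope ring_scope.

Definition legendre (p : nat) (a : int) : int :=
  if (p%:Z %| a)%Z then 0
  else if [exists x : 'I_p, (p%:Z %| (x%:Z) ^+ 2 - a)%Z] then 1 else -1.

Definition Smdet (m : nat) (d : int) (p : nat) : int :=
  \det (\matrix_(j < (p.-1)./2, k < (p.-1)./2)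
          (((j.+1)%:Z) ^+ 2 + d * ((k.+1)%:Z) ^+ 2) ^+ m).

Definition Tinv (e : nat) (d : int) (p : nat) : rat :=
  \det (\matrix_(j < (p.-1)./2, k < (p.-1)./2)
          ((((j.+1)%:Z) ^+ 2 + d * ((k.+1)%:Z) ^+ 2)%:~R ^+ e)^-1).

(* x = y (mod p) in the ring of rationals with denominator prime to p:
   x - y = p * z with z p-integral. *)
Definition rat_eqmod (p : nat) (x y : rat) : Prop :=
  (p%:Z %| numq (x - y))%Z /\ ~~ (p%:Z %| denq (x - y))%Z.

(* Main.v *)
(* Modulo p the squares x_1, ..., x_n (n = (p-1)/2) are the n-th roots of unity,
   and c = -d satisfies c^n = -1.  Up to column factors the matrix
   ((x_j - c x_k)^-e) depends only on x_j / x_k, so the Vandermonde matrix of the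
   x_j diagonalises it, with eigenvalues L e r = sum_j x_j^r / (x_j - c)^e.  From
   L (e+1) (r+1) = c L (e+1) r + L e r and the n-periodicity of L in r one reads
   off L 1 r and L 2 r, hence both determinants; the Legendre symbols then follow
   from Euler's criterion, with 2^n computed by Gauss's argument. *)
Require Import Defs.
From mathcomp Require Import all_boot all_order all_algebra.
From mathcomp Require Import finfield ring zify.
Import Order.TTheory GRing.Theory Num.Theory.
Local Open Scope ring_scope.

(** * Sums and products over the [n]-th roots of unity *)

(** [X^n - 1] has at most [n] roots, and the distinct values of [x] already supply [n] of them, so a
    further root [y] is impossible. *)
Lemma mem_unity_family (F : fieldType) (n : nat) (x : 'I_n -> F) (y : F) :
  injective x -> (forall j, x j ^+ n = 1) -> (0 < n)%N ->
  (y \in map x (enum 'I_n)) = (y ^+ n == 1).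
Proof.
move=> xinj xn n_gt0; apply/mapP/idP => [[j _ ->]|/eqP yn]; first by rewrite xn.
apply/mapP; apply/negPn/negP => y_notin.
have pn0 : 'X^n - 1%:P != 0 :> {poly F}.
  by rewrite -size_poly_eq0 size_XnsubC.
have := @max_poly_roots _ ('X^n - 1%:P) (y :: map x (enum 'I_n)) pn0.
rewrite size_XnsubC //= size_map size_enum_ord ltnn y_notin.
rewrite (map_inj_uniq xinj) enum_uniq /root !hornerE yn subrr eqxx /=.
suff -> : all (root ('X^n - 1%:P)) (map x (enum 'I_n)) by move=> /(_ isT isT).
by apply/allP => _ /mapP[j _ ->]; rewrite /root !hornerE xn subrr.
Qed.

(** Multiplication by the root of unity [y] permutes the set of all [n]-th roots of unity. *)
Lemma sum_unity_mul (F : fieldType) (n : nat) (x : 'I_n -> F)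
    (y : F) (f : F -> F) :
  injective x -> (forall j, x j ^+ n = 1) -> (0 < n)%N -> y ^+ n = 1 ->
  \sum_j f (y * x j) = \sum_j f (x j).
Proof.
move=> xinj xn n_gt0 yn.
have y_neq0 : y != 0.
  by apply/eqP => y0; move/eqP: yn; rewrite y0 expr0n gtn_eqF // eq_sym oner_eq0.
have yinj : injective ( *%R y) by apply: mulfI.
have -> : \sum_j f (x j) = \sum_(z <- map x (enum 'I_n)) f z.
  by rewrite big_map [RHS]big_enum.
have -> : \sum_j f (y * x j) = \sum_(z <- map ( *%R y) (map x (enum 'I_n))) f z.
  by rewrite 2!big_map [RHS]big_enum.
apply: perm_big; apply: uniq_perm.
- by rewrite 2?map_inj_uniq // enum_uniq.
- by rewrite map_inj_uniq // enum_uniq.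
move=> z; rewrite -(divfK y_neq0 z) mulrC; move: (z / y) => w.
rewrite (mem_map yinj) !mem_unity_family //.
by rewrite exprMn yn mul1r.
Qed.

(** Compare the constant terms in the factorisation of [X^n - 1] into the linear factors
    [X - x j]. *)
Lemma prod_unity (F : fieldType) (n : nat) (x : 'I_n -> F) :
  injective x -> (forall j, x j ^+ n = 1) -> (0 < n)%N ->
  \prod_j x j = (-1) ^+ n.+1.
Proof.
move=> xinj xn n_gt0.
have E : 'X^n - 1%:P = \prod_(z <- map x (enum 'I_n)) ('X - z%:P).
  have rs : all (root ('X^n - 1%:P)) (map x (enum 'I_n)).
    by apply/allP => _ /mapP[j _ ->]; rewrite /root !hornerE xn subrr.
  have us : uniq_roots (map x (enum 'I_n)).
    by rewrite uniq_rootsE map_inj_uniq // enum_uniq.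
  have sz : size ('X^n - 1%:P : {poly F}) = (size (map x (enum 'I_n))).+1.
    by rewrite size_XnsubC // size_map size_enum_ord.
  by rewrite (all_roots_prod_XsubC sz rs us) lead_coefXnsubC // scale1r.
have := congr1 (fun q => q.[0]) E.
rewrite horner_prod big_map big_enum /= !hornerE expr0n gtn_eqF //=.
under eq_bigr do rewrite !hornerE.
rewrite add0r prodrN card_ord => H.
by rewrite exprSr {2}H mulrA -exprD -signr_odd addnn odd_double mul1r.
Qed.

(** As [X^r - 1] has fewer than [n] roots, some [x j ^+ r] differs from 1. Multiplying the roots by
    this [x j] fixes the sum but also scales it by [x j ^+ r]. *)
Lemma sum_unity_expr (F : fieldType) (n r : nat) (x : 'I_n -> F) :
  injective x -> (forall j, x j ^+ n = 1) -> (0 < r < n)%N ->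
  \sum_j x j ^+ r = 0.
Proof.
move=> xinj xn /andP[r_gt0 r_lt_n].
have n_gt0 : (0 < n)%N by apply: leq_ltn_trans r_lt_n.
have [j xr] : exists j, x j ^+ r != 1.
  apply/existsP; apply: contraT; rewrite negb_exists => /forallP xr.
  have pn0 : 'X^r - 1%:P != 0 :> {poly F}.
    by rewrite -size_poly_eq0 size_XnsubC.
  have := @max_poly_roots _ ('X^r - 1%:P) (map x (enum 'I_n)) pn0.
  rewrite size_XnsubC //= size_map size_enum_ord map_inj_uniq // enum_uniq.
  suff -> : all (root ('X^r - 1%:P)) (map x (enum 'I_n)).
    by move=> /(_ isT isT); rewrite ltnS leqNgt r_lt_n.
  apply/allP => _ /mapP[j _ ->]; rewrite /root !hornerE.
  by move: (xr j); rewrite negbK => /eqP ->; rewrite subrr.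
have := @sum_unity_mul F n x (x j) (fun z => z ^+ r) xinj xn n_gt0 (xn j).
under eq_bigr do rewrite exprMn.
rewrite -mulr_sumr => H.
apply/eqP; rewrite -(mulrI_eq0 _ (mulfI (_ : x j ^+ r - 1 != 0))) ?subr_eq0 //.
by rewrite mulrBl mul1r H subrr.
Qed.

(** * The eigenvalues and the diagonalisation *)

(** These are the numbers [L e r]; at [e = 0] they are plain power sums, which start the
    recurrence. *)
Definition twisted_sum (F : fieldType) (n : nat) (x : 'I_n -> F) (c : F)
    (e r : nat) : F :=
  \sum_j x j ^+ r * ((x j - c) ^+ e)^-1.

(** Replacing [x j] by [x k * x j] in entry [(r, k)] of [V *m M] pulls out [x k ^+ r.+1 / x k ^+ e]
    and leaves a sum free of [k]. Hence [V *m M] is [V] with rows scaled by the twisted sums and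
    columns by [x k ^- e], and [\det V] cancels. *)
Lemma det_unity_diff (F : fieldType) (n e : nat) (x : 'I_n -> F) (c : F) :
  injective x -> (forall j, x j ^+ n = 1) ->
  \det (\matrix_(j, k) ((x j - c * x k) ^+ e)^-1)
  = (\prod_j x j)^-1 ^+ e * \prod_(r < n) twisted_sum F n x c e r.+1.
Proof.
move=> xinj xn.
have x_neq0 j : x j != 0.
  apply/eqP => x0; move/eqP: (xn j).
  by rewrite x0 expr0n gtn_eqF ?(leq_ltn_trans _ (ltn_ord j)) // eq_sym oner_eq0.
(* Exponents run from 1 to [n], the range on which the recurrence gives clean formulas; the shift
   only scales column [j] of the Vandermonde matrix by [x j]. *)
pose V := \matrix_(r < n, j < n) x j ^+ r.+1.
have VE : V = Vandermonde n (\row_j x j) *m diag_mx (\row_j x j).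
  by rewrite mul_mx_diag; apply/matrixP => r j; rewrite !mxE exprSr.
have detV : \det V != 0.
  rewrite VE det_mulmx det_Vandermonde det_diag mulf_neq0 //.
    apply/prodf_neq0 => i _; apply/prodf_neq0 => j ltij.
    by rewrite !mxE subr_eq0 (inj_eq xinj) eq_sym; apply: contraTneq ltij => ->;
      rewrite ltnn.
  by apply/prodf_neq0 => j _; rewrite mxE.
set M := \matrix_(j, k) _.
have VM : V *m M = diag_mx (\row_(r < n) twisted_sum F n x c e r.+1)
                   *m (V *m diag_mx (\row_j (x j)^-1 ^+ e)).
  rewrite mul_mx_diag mul_diag_mx; apply/matrixP => r k; rewrite !mxE.
  have n_gt0 : (0 < n)%N by apply: leq_ltn_trans (ltn_ord k).
  under eq_bigr do rewrite !mxE.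
  rewrite -(@sum_unity_mul F n x (x k)
             (fun z => z ^+ r.+1 * ((z - c * x k) ^+ e)^-1)) //.
  rewrite /twisted_sum mulr_suml; apply: eq_bigr => j _.
  rewrite (_ : x k * x j - c * x k = x k * (x j - c)); last by ring.
  by rewrite !exprMn invfM exprVn; ring.
apply: (mulfI detV); rewrite -det_mulmx VM !det_mulmx !det_diag.
under eq_bigr do rewrite mxE.
under [X in _ * (_ * X)]eq_bigr do rewrite mxE.
by rewrite -prodfV prodrXl; ring.
Qed.

Lemma twisted_sum0 (F : fieldType) (n r : nat) (x : 'I_n -> F) (c : F) :
  twisted_sum F n x c 0 r = \sum_j x j ^+ r.
Proof. by apply: eq_bigr => j _; rewrite expr0 invr1 mulr1. Qed.

Lemma twisted_sumD (F : fieldType) (n e r : nat) (x : 'I_n -> F) (c : F) :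
  (forall j, x j ^+ n = 1) ->
  twisted_sum F n x c e (n + r) = twisted_sum F n x c e r.
Proof. by move=> xn; apply: eq_bigr => j _; rewrite exprD xn mul1r. Qed.

(** Write one factor [x j] as [c + (x j - c)]; the second summand cancels one power of the
    denominator. *)
Lemma twisted_sumS (F : fieldType) (n e r : nat) (x : 'I_n -> F) (c : F) :
  (forall j, x j != c) ->
  twisted_sum F n x c e.+1 r.+1
  = c * twisted_sum F n x c e.+1 r + twisted_sum F n x c e r.
Proof.
move=> xc; rewrite /twisted_sum mulr_sumr -big_split /=; apply: eq_bigr => j _.
have xcj : x j - c != 0 by rewrite subr_eq0.
have -> : ((x j - c) ^+ e)^-1 = (x j - c) * ((x j - c) ^+ e.+1)^-1.
  by rewrite exprS invfM mulVKf.
by rewrite exprS; ring.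
Qed.

(** Power sums of exponent strictly between 0 and [n] vanish, so the sequence is geometric of ratio
    [c] on indices 1 to [n]. One more step returns to index 1 and adds the power sum [n]:
    [L = c^n L + n = - L + n]. *)
Lemma twisted_sum1 (F : fieldType) (n r : nat) (x : 'I_n -> F) (c : F) :
  injective x -> (forall j, x j ^+ n = 1) -> c ^+ n = -1 ->
  (-1 : F) != 1 -> (r < n)%N ->
  2 * twisted_sum F n x c 1 r.+1 = n%:R * c ^+ r.
Proof.
move=> xinj xn cn neq11 r_lt_n.
have xc j : x j != c by apply: contra_neq neq11 => xjc; rewrite -cn -(xn j) xjc.
have geom s : (s < n)%N ->
    twisted_sum F n x c 1 s.+1 = c ^+ s * twisted_sum F n x c 1 1.
  elim: s => [|s IH] s_lt; first by rewrite expr0 mul1r.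
  rewrite twisted_sumS // IH 1?ltnW // twisted_sum0 sum_unity_expr // addr0.
  by rewrite exprS mulrA.
have L1 : 2 * twisted_sum F n x c 1 1 = n%:R.
  have n_gt0 : (0 < n)%N by apply: leq_ltn_trans r_lt_n.
  have := @twisted_sumS F n 0 n x c xc.
  have := geom n.-1; rewrite prednK // => -> //.
  rewrite -[n.+1]addn1 twisted_sumD // twisted_sum0.
  rewrite mulrA -exprS prednK // cn.
  under eq_bigr do rewrite xn.
  rewrite sumr_const card_ord => H.
  by rewrite mulr2n mulrDl mul1r {1}H mulN1r addrAC addNr add0r.
by rewrite geom // mulrCA L1 mulrC.
Qed.

(** The forcing term is itself geometric of ratio [c], so the solution is [c ^+ s] times a function
    affine in [s]. Periodicity at [s = n], with [c ^+ n = -1], fixes the initial value. *)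
Lemma twisted_sum2 (F : fieldType) (n r : nat) (x : 'I_n -> F) (c : F) :
  injective x -> (forall j, x j ^+ n = 1) -> c ^+ n = -1 ->
  (-1 : F) != 1 -> (r < n)%N ->
  4 * c * twisted_sum F n x c 2 r.+1 = n%:R * (2 * r%:R - n%:R) * c ^+ r.
Proof.
move=> xinj xn cn neq11 r_lt_n.
have xc j : x j != c by apply: contra_neq neq11 => xjc; rewrite -cn -(xn j) xjc.
have arith s : (s <= n)%N -> 2 * c * twisted_sum F n x c 2 s.+1
    = c ^+ s * (2 * c * twisted_sum F n x c 2 1 + s%:R * n%:R).
  elim: s => [|s IH] s_lt; first by rewrite expr0; ring.
  rewrite twisted_sumS // mulrDr mulrCA IH 1?ltnW //.
  rewrite [X in _ + X]mulrAC twisted_sum1 // exprS -natr1; ring.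
have L1 : 4 * c * twisted_sum F n x c 2 1 = - n%:R ^+ 2.
  have := arith n (leqnn n); rewrite -[n.+1]addn1 twisted_sumD // cn => H.
  have -> : 4 * c * twisted_sum F n x c 2 1 =
    2 * c * twisted_sum F n x c 2 1 + 2 * c * twisted_sum F n x c 2 1 by ring.
  by rewrite {1}H; ring.
have -> : 4 * c * twisted_sum F n x c 2 r.+1
          = 2 * (2 * c * twisted_sum F n x c 2 r.+1) by ring.
rewrite arith 1?ltnW //.
have -> t : 2 * (c ^+ r * (2 * c * t + r%:R * n%:R))
       = c ^+ r * (4 * c * t + 2 * r%:R * n%:R) by ring.
by rewrite L1; ring.
Qed.

(** * Closed forms of the two determinants *)

Lemma prod_expr_bin (R : comPzRingType) (n : nat) (c : R) :
  \prod_(r < n) c ^+ r = c ^+ 'C(n, 2).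
Proof. by rewrite -bin2_sum big_mkord prodrXr. Qed.

(** The equation [2 * n%:R = -1] is how [n = (p-1)/2] enters over a general field. *)
Lemma double_eqN1_facts (F : fieldType) (n : nat) :
  2 * n%:R = -1 :> F ->
  [/\ 2 != 0 :> F, 4 != 0 :> F, -1 != 1 :> F & n%:R = - 2^-1 :> F].
Proof.
move=> n2.
have two0 : 2 != 0 :> F.
  by apply/eqP => z; move/eqP: n2; rewrite z mul0r eq_sym oppr_eq0 oner_eq0.
split=> //.
- by rewrite (_ : 4 = 2 * 2) ?mulf_neq0 //; ring.
- by rewrite -subr_eq0 (_ : -1 - 1 = - 2) ?oppr_eq0 //; ring.
- by apply: (mulfI two0); rewrite n2; field.
Qed.

(** With [n = -1/2] the eigenvalues are [- c^r / 4]; the powers of 4 multiply to 1, and the signs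
    [(-1)^(n+1)] and [(-1)^n] leave -1. *)
Lemma det_unity_diff1 (F : fieldType) (n : nat) (x : 'I_n -> F) (c : F) :
  injective x -> (forall j, x j ^+ n = 1) -> c ^+ n = -1 ->
  (0 < n)%N -> 2 * n%:R = -1 :> F -> 4 ^+ n = 1 :> F ->
  \det (\matrix_(j, k) ((x j - c * x k) ^+ 1)^-1) = - c ^+ 'C(n, 2).
Proof.
move=> xinj xn cn n_gt0 n2 n4.
have [two0 four0 neq11 nE] := double_eqN1_facts F n n2.
rewrite det_unity_diff // prod_unity //.
under eq_bigr => r _.
  have -> : twisted_sum F n x c 1 r.+1 = - 4^-1 * c ^+ r.
    by apply: (mulfI two0); rewrite twisted_sum1 // nE; field; rewrite ?two0 ?four0.
  over.
rewrite big_split /= prodr_const card_ord prod_expr_bin.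
rewrite expr1 invr_sign (exprNn 4^-1) exprVn n4 invr1 mulr1 mulrA -exprD.
rewrite addSn addnn.
by rewrite exprS -signr_odd odd_double mulr1 mulN1r.
Qed.

(** With [n = -1/2] the eigenvalues are [- c^r (r + 1/4) / (4 c)]. The product of the roots enters
    squared, and [c^-n = -1] supplies the extra sign. *)
Lemma det_unity_diff2 (F : fieldType) (n : nat) (x : 'I_n -> F) (c : F) :
  injective x -> (forall j, x j ^+ n = 1) -> c ^+ n = -1 ->
  (0 < n)%N -> 2 * n%:R = -1 :> F -> 4 ^+ n = 1 :> F ->
  \det (\matrix_(j, k) ((x j - c * x k) ^+ 2)^-1)
  = (-1) ^+ n.+1 * c ^+ 'C(n, 2) * \prod_(r < n) (r%:R + 4^-1).
Proof.
move=> xinj xn cn n_gt0 n2 n4.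
have [two0 four0 neq11 nE] := double_eqN1_facts F n n2.
have c0 : c != 0.
  apply/eqP => z; move/eqP: cn.
  by rewrite z expr0n gtn_eqF //= eq_sym oppr_eq0 oner_eq0.
rewrite det_unity_diff // prod_unity //.
under eq_bigr => r _.
  have -> : twisted_sum F n x c 2 r.+1 = - 4^-1 * c^-1 * c ^+ r * (r%:R + 4^-1).
    apply: (mulfI (mulf_neq0 four0 c0)).
    by rewrite twisted_sum2 // nE; field; rewrite ?two0 ?four0 ?c0.
  over.
rewrite !big_split /= !prodr_const card_ord prod_expr_bin.
rewrite invr_sign sqrr_sign mul1r (exprNn 4^-1) (exprVn 4) (exprVn c) n4 cn.
by rewrite invr1 mulr1 invrN1 exprSr.
Qed.

(** Since [n = -1/2], the factors at [r] and [n - r] are opposite. Index 0 gives the lone [1/4], and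
    the other [2m] indices form [m] pairs. *)
Lemma prod_quarter_sym (F : fieldType) (m : nat) :
  2 * (m.*2.+1)%:R = -1 :> F ->
  \prod_(r < m.*2.+1) (r%:R + 4^-1)
  = (-1) ^+ m * (4^-1 * \prod_(1 <= r < m.+1) (r%:R + 4^-1) ^+ 2) :> F.
Proof.
move=> n2; have [two0 four0 neq11 nE] := double_eqN1_facts F _ n2.
rewrite -(big_mkord xpredT (fun r => r%:R + 4^-1)) big_nat_recl // add0r.
rewrite mulrCA; congr (_ * _).
rewrite -addnn (big_cat_nat _ (leq_addr m m)) //= prodrXl big_add1 /=.
rewrite expr2 mulrCA; congr (_ * _).
rewrite -{1}[m]add0n big_addn addnK big_nat_rev /= add0n.
rewrite -[m in (-1) ^+ m]subn0 -(prodr_const_nat 0 m) -big_split /=.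
apply: eq_big_nat => i /andP[_ im].
have -> : ((m - i.+1 + m).+1)%:R = (m.*2.+1)%:R - i.+1%:R :> F.
  by rewrite -natrB; [congr (_%:R); lia | lia].
by rewrite nE -natr1; field; rewrite ?two0 ?four0.
Qed.

(** The factor at [r = m] vanishes, because [m = n/2 = -1/4] in [F]. *)
Lemma prod_quarter_eq0 (F : fieldType) (n m : nat) :
  2 * n%:R = -1 :> F -> n = m.*2 -> (0 < n)%N ->
  \prod_(r < n) (r%:R + 4^-1) = 0 :> F.
Proof.
move=> n2 nm n_gt0; have [two0 four0 neq11 nE] := double_eqN1_facts F _ n2.
have mn : (m < n)%N by lia.
rewrite (bigD1 (Ordinal mn)) //=; apply/eqP; rewrite mulf_eq0; apply/orP; left.
apply/eqP/(mulfI four0); rewrite mulr0 mulrDr mulfV // (_ : 4 * m%:R = 2 * n%:R).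
  by rewrite n2 addNr.
by rewrite nm -mul2n natrM mulrA; congr (_ * _); ring.
Qed.

(** * The value of [2^n] by Gauss's argument *)

Lemma fact_odd_even (n : nat) :
  n`! = (\prod_(i < uphalf n) i.*2.+1 * (2 ^ n./2 * (n./2)`!))%N.
Proof.
have even k : (k.*2)`! = (\prod_(i < k) i.*2.+1 * (2 ^ k * k`!))%N.
  elim: k => [|k IH]; first by rewrite big_ord0.
  by rewrite doubleS 2!factS IH big_ord_recr /= factS expnS; lia.
rewrite -(odd_double_half n); case: (odd n); set k := n./2.
  have [-> ->] : uphalf (1 + k.*2) = k.+1 /\ (1 + k.*2)./2 = k by split; lia.
  by rewrite factS even big_ord_recr /=; lia.
have [-> ->] : uphalf (0 + k.*2) = k /\ (0 + k.*2)./2 = k by split; lia.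
exact: even.
Qed.

(* The odd factors 2i+1 of n! equal -2(n-i) because 2n = -1. *)
Lemma euler_two (F : fieldType) (n : nat) :
  2 * n%:R = -1 :> F -> n`!%:R != 0 :> F ->
  2 ^+ n = (-1) ^+ uphalf n :> F.
Proof.
move=> n2 nf0.
have le_n : (uphalf n <= n)%N by lia.
have odds k : (k <= n)%N ->
    (\prod_(i < k) i.*2.+1)%:R = (- 2) ^+ k * (n ^_ k)%:R :> F.
  move=> le_kn; rewrite ffact_prod !natr_prod.
  have -> : (- 2) ^+ k = \prod_(i < k) (- 2) :> F.
    by rewrite prodr_const card_ord.
  rewrite -big_split /=; apply: eq_bigr => i _.
  have lt_in : (i < n)%N by apply: leq_trans le_kn.
  rewrite natrB 1?ltnW // mulrBr mulNr n2 -natr1 -mul2n natrM; ring.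
(* With [u = uphalf n], this reads [n! = (-2)^u * n^_u * 2^(n./2) * (n./2)!]; cancelling
   [n! = n^_u * (n./2)!] leaves [1 = (-1)^u * 2^n]. *)
have := congr1 (fun z => z%:R : F) (fact_odd_even n).
rewrite 2!natrM odds // natrX -{1}(ffact_fact le_n) natrM.
have -> : (n - uphalf n)%N = n./2 by lia.
move: nf0; rewrite -(ffact_fact le_n) natrM.
have -> : (n - uphalf n)%N = n./2 by lia.
move=> nf0 H; apply: (mulIf nf0); rewrite {2}H.
have -> : 2 ^+ n = 2 ^+ uphalf n * 2 ^+ n./2 :> F.
  by rewrite -exprD; congr (_ ^+ _); lia.
rewrite (exprNn 2); have := sqrr_sign F (uphalf n).
set s := (-1) ^+ _ => ss.
rewrite -[LHS]mul1r -{1}ss; ring.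
Qed.

(** * Squares modulo [p] and Euler's criterion *)

Lemma Fp_fermat (p : nat) (a : 'F_p) : prime p -> a != 0 -> a ^+ p.-1 = 1.
Proof.
move=> pp a0; apply: (mulfI a0); rewrite -exprS prednK ?prime_gt0 // mulr1.
by have := expf_card a; rewrite card_Fp.
Qed.

Lemma Fp_nat_neq0 (p k : nat) : prime p -> (0 < k < p)%N -> k%:R != 0 :> 'F_p.
Proof.
move=> pp /andP[k0 kp]; rewrite -(dvdn_pcharf (pchar_Fp pp)).
by apply/negP => /dvdn_leq; lia.
Qed.

Lemma Fp_double_half (p : nat) :
  prime p -> odd p -> 2 * (p.-1./2)%:R = -1 :> 'F_p.
Proof.
move=> pp op; rewrite -natrM; apply/eqP; rewrite eq_sym eqr_oppLR -subr_eq0.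
rewrite opprK addrC natr1 mul2n.
have -> : (p.-1./2.*2).+1 = p by have := prime_gt0 pp; lia.
by rewrite pcharf0 // pchar_Fp.
Qed.

Definition Fp_sq (p : nat) (j : 'I_(p.-1./2)) : 'F_p := (j.+1)%:R ^+ 2.

(** Equal squares make [p] divide the difference or the sum of the bases, and the sum lies strictly
    between 0 and [p]. *)
Lemma Fp_sq_inj (p : nat) : prime p -> injective (Fp_sq p).
Proof.
move=> pp; have pos : forall i : 'I_(p.-1./2), (i.+1 < p)%N.
  by move=> i; have := ltn_ord i; lia.
have le : forall j k : 'I_(p.-1./2), (k <= j)%N -> Fp_sq p j = Fp_sq p k -> j = k.
  move=> j k kj /eqP; rewrite eqf_sqr => /orP[]; rewrite -subr_eq0.
    rewrite -natrB // subSS -(dvdn_pcharf (pchar_Fp pp)) => d.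
    apply: val_inj => /=; apply/eqP; rewrite eqn_leq kj andbT -subn_eq0.
    apply/negPn/negP; rewrite -lt0n => d0; have := dvdn_leq d0 d.
    by have := pos j; lia.
  rewrite opprK -natrD (negbTE (Fp_nat_neq0 p (j.+1 + k.+1) pp _)) //.
  by have := ltn_ord j; have := ltn_ord k; lia.
move=> j k E; case: (leqP k j) => [kj | /ltnW jk]; first exact: le.
by symmetry; apply: le.
Qed.

Lemma Fp_sq_unity (p : nat) (j : 'I_(p.-1./2)) :
  prime p -> odd p -> Fp_sq p j ^+ p.-1./2 = 1.
Proof.
move=> pp op; rewrite -exprM mul2n.
have -> : p.-1./2.*2 = p.-1 by have := prime_gt0 pp; lia.
apply: Fp_fermat => //; apply: Fp_nat_neq0 => //.
by have := ltn_ord j; lia.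
Qed.

(** Euler's criterion. A nonzero [a] has [a^n] equal to 1 or -1; the value 1 makes [a] an [n]-th
    root of unity, and these are exhausted by the squares [Fp_sq]. *)
Lemma legendre_Fp (p : nat) (a : int) : prime p -> odd p ->
  (legendre p a)%:~R = a%:~R ^+ p.-1./2 :> 'F_p.
Proof.
move=> pp op; have ch := pchar_Fp pp.
have n0 : (0 < p.-1./2)%N by have := odd_prime_gt2 op pp; lia.
have pE : (p.-1./2 * 2)%N = p.-1 by have := prime_gt0 pp; lia.
rewrite /legendre (dvdz_pcharf ch); case: (eqVneq (a%:~R : 'F_p) 0) => [-> | a0].
  by rewrite expr0n gtn_eqF.
case: existsP => [[x] | nsq].
  rewrite (dvdz_pcharf ch) rmorphB rmorphXn /= subr_eq0 => /eqP xa.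
  rewrite -xa -exprM mulnC pE Fp_fermat //.
  by move: a0; rewrite -xa expf_eq0.
have : (a%:~R ^+ p.-1./2 : 'F_p) ^+ 2 == 1 ^+ 2.
  by rewrite -exprM pE Fp_fermat // expr1n.
rewrite eqf_sqr => /orP[/eqP an | /eqP -> //]; case: nsq.
have := mem_unity_family _ _ (Fp_sq p) (a%:~R) (Fp_sq_inj p pp).
move=> /(_ (fun j => Fp_sq_unity p j pp op) n0); rewrite an eqxx.
case/mapP => j _ ja.
have jp : (j.+1 < p)%N by have := ltn_ord j; lia.
exists (Ordinal jp); rewrite (dvdz_pcharf ch) rmorphB rmorphXn /= subr_eq0.
by rewrite ja.
Qed.

(** The possible values 0, 1, -1 stay distinct modulo an odd prime. *)
Lemma legendre_eq (p : nat) (a b : int) : prime p -> odd p ->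
  a%:~R ^+ p.-1./2 = b%:~R ^+ p.-1./2 :> 'F_p -> legendre p a = legendre p b.
Proof.
move=> pp op; rewrite -!legendre_Fp // => E.
have [_ _ neq11 _] := double_eqN1_facts _ _ (Fp_double_half p pp op).
have one0 := oner_neq0 'F_p; have mone0 : -1 != 0 :> 'F_p by rewrite oppr_eq0.
have vals c : [\/ legendre p c = 0, legendre p c = 1 | legendre p c = -1].
  rewrite /legendre; case: ifP => _; first by constructor 1.
  by case: ifP => _; [constructor 2 | constructor 3].
have simp := (negbTE one0, negbTE mone0, negbTE neq11).
move/eqP: E; case: (vals a) => ->; case: (vals b) => -> //=;
  by rewrite ?mulr0z ?mulrNz ?mulr1z ?simp // eq_sym simp.
Qed.

Lemma legendre_0 (p : nat) : legendre p 0 = 0.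
Proof. by rewrite /legendre dvdz0. Qed.

Lemma legendre_1 (p : nat) : prime p -> legendre p 1 = 1.
Proof.
move=> pp; rewrite /legendre (dvdz_pcharf (pchar_Fp pp)) mulr1z oner_eq0.
case: existsP => // -[]; exists (Ordinal (prime_gt1 pp)).
by rewrite expr1n subrr dvdz0.
Qed.

(** * Reduction of [p]-integral rationals *)

(* The rational x is p-integral and its residue modulo p is a. *)
Definition reduces (p : nat) (x : rat) (a : 'F_p) : Prop :=
  exists u v : int, [/\ v%:~R != 0 :> 'F_p, x = u%:~R / v%:~R & a = u%:~R / v%:~R].

Lemma intr_Fp_rat_neq0 (p : nat) (v : int) :
  v%:~R != 0 :> 'F_p -> v%:~R != 0 :> rat.
Proof. by rewrite intr_eq0; apply: contra_neq => ->. Qed.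

Lemma reduces_int (p : nat) (z : int) : reduces p z%:~R z%:~R.
Proof. by exists z, 1; rewrite !divr1 oner_neq0. Qed.

Lemma reducesD (p : nat) (x y : rat) (a b : 'F_p) :
  reduces p x a -> reduces p y b -> reduces p (x + y) (a + b).
Proof.
move=> [u [v [v0 -> ->]]] [u' [v' [v0' -> ->]]].
have [w0 w0'] := (intr_Fp_rat_neq0 _ _ v0, intr_Fp_rat_neq0 _ _ v0').
exists (u * v' + u' * v), (v * v'); rewrite !rmorphD !rmorphM /=.
by rewrite mulf_neq0 // !addf_div.
Qed.

Lemma reducesM (p : nat) (x y : rat) (a b : 'F_p) :
  reduces p x a -> reduces p y b -> reduces p (x * y) (a * b).
Proof.
move=> [u [v [v0 -> ->]]] [u' [v' [v0' -> ->]]].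
by exists (u * u'), (v * v'); rewrite !rmorphM /= mulf_neq0 // !mulf_div.
Qed.

Lemma reducesV (p : nat) (x : rat) (a : 'F_p) :
  a != 0 -> reduces p x a -> reduces p x^-1 a^-1.
Proof.
move=> a0 [u [v [v0 -> aE]]]; exists v, u; split; rewrite ?aE ?invf_div //.
by apply: contraNneq a0 => u0; rewrite aE u0 mul0r.
Qed.

Lemma reduces_prod (p : nat) (I : Type) (r : seq I) (P : pred I)
    (f : I -> rat) (g : I -> 'F_p) :
  (forall i, P i -> reduces p (f i) (g i)) ->
  reduces p (\prod_(i <- r | P i) f i) (\prod_(i <- r | P i) g i).
Proof.
apply: big_ind2; first exact: (reduces_int p 1).
by move=> *; apply: reducesM.
Qed.

Lemma reduces_exp (p m : nat) (x : rat) (a : 'F_p) :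
  reduces p x a -> reduces p (x ^+ m) (a ^+ m).
Proof.
move=> xa; elim: m => [|m IH]; first exact: (reduces_int p 1).
by rewrite !exprS; apply: reducesM.
Qed.

Lemma reduces_det (p n : nat) (A : 'M[rat]_n) (B : 'M['F_p]_n) :
  (forall i j, reduces p (A i j) (B i j)) -> reduces p (\det A) (\det B).
Proof.
move=> AB; apply: big_ind2 => [||s _]; first exact: (reduces_int p 0).
  by move=> *; apply: reducesD.
apply: reducesM; last by apply: reduces_prod.
by apply: reduces_exp; apply: (reduces_int p (-1)).
Qed.

(** The difference is [u / v] with [p] dividing [u] but not [v]. Cross-multiplying with its reduced
    form puts [p] in the numerator, and coprimality keeps it out of the denominator. *)
Lemma reduces_eqmod (p : nat) (x y : rat) (a : 'F_p) : prime p ->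
  reduces p x a -> reduces p y a -> rat_eqmod p x y.
Proof.
move=> pp xa ya; have ch := pchar_Fp pp.
have := reducesD _ _ _ _ _ xa (reducesM _ _ _ _ _ (reduces_int p (-1)) ya).
rewrite !mulrN1z !mulN1r subrr => -[u [v [v0 E u0]]].
have {u0} u0 : u%:~R = 0 :> 'F_p.
  by apply: (mulIf (invr_neq0 v0)); rewrite -u0 mul0r.
have {E} cross : numq (x - y) * v = u * denq (x - y).
  apply: (@intr_inj rat); rewrite !rmorphM /=.
  apply/eqP; rewrite -eqr_div ?(intr_Fp_rat_neq0 _ _ v0) ?intr_eq0 ?denq_neq0 //.
  by rewrite divq_num_den E.
have pnum : (p %| numq (x - y))%Z.
  rewrite (dvdz_pcharf ch); have := congr1 (fun z => z%:~R : 'F_p) cross.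
  by rewrite !rmorphM /= u0 mul0r => /eqP; rewrite mulf_eq0 (negbTE v0) orbF.
split=> //; apply/negP => pden.
have := coprime_num_den (x - y); rewrite /coprime => /eqP g1.
have : (p %| gcdn `|numq (x - y)| `|denq (x - y)|)%N.
  by rewrite dvdn_gcd; move: pnum pden; rewrite !dvdzE => -> ->.
by rewrite g1 dvdn1 gtn_eqF // prime_gt1.
Qed.

(** * The determinants modulo [p] *)

(** With [c = -d] this is the common residue of [Tinv e d p] and [Smdet (p - 1 - e) d p]. *)
Definition Fp_det (p e : nat) (c : 'F_p) : 'F_p :=
  \det (\matrix_(j < p.-1./2, k < p.-1./2) ((Fp_sq p j - c * Fp_sq p k) ^+ e)^-1).

Lemma Fp_entry (p : nat) (d : int) (j k : 'I_(p.-1./2)) :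
  ((j.+1)%:Z ^+ 2 + d * (k.+1)%:Z ^+ 2)%:~R
  = Fp_sq p j - (- d)%:~R * Fp_sq p k :> 'F_p.
Proof.
by rewrite rmorphD rmorphM !rmorphXn /= mulrNz mulNr opprK.
Qed.

(** Raising [x_j = c x_k] to the power [n] would give [1 = -1]. *)
Lemma Fp_entry_neq0 (p : nat) (c : 'F_p) (j k : 'I_(p.-1./2)) :
  prime p -> odd p -> c ^+ p.-1./2 = -1 -> Fp_sq p j - c * Fp_sq p k != 0.
Proof.
move=> pp op cn; have [_ _ neq11 _] := double_eqN1_facts _ _ (Fp_double_half p pp op).
rewrite subr_eq0; apply: contra_neq neq11 => E.
by have := Fp_sq_unity p j pp op; rewrite E exprMn cn Fp_sq_unity // mulr1.
Qed.

Lemma Tinv_reduces (p e : nat) (d : int) :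
  prime p -> odd p -> (- d)%:~R ^+ p.-1./2 = -1 :> 'F_p ->
  reduces p (Tinv e d p) (Fp_det p e (- d)%:~R).
Proof.
move=> pp op cn; apply: reduces_det => j k; rewrite !mxE.
apply: reducesV; first by rewrite expf_neq0 // Fp_entry_neq0.
by apply: reduces_exp; rewrite -Fp_entry; apply: reduces_int.
Qed.

(** By Fermat each entry [z] satisfies [z^m * z^e = 1], so [z^m] is the inverse of [z^e]. *)
Lemma Smdet_Fp (p m e : nat) (d : int) :
  prime p -> odd p -> (- d)%:~R ^+ p.-1./2 = -1 :> 'F_p -> (m + e)%N = p.-1 ->
  (Smdet m d p)%:~R = Fp_det p e (- d)%:~R.
Proof.
move=> pp op cn me; rewrite /Smdet -(det_map_mx (intr : {rmorphism int -> 'F_p})).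
congr (\det _); apply/matrixP => j k; rewrite !mxE rmorphXn /= Fp_entry.
have z0 := Fp_entry_neq0 p _ j k pp op cn.
apply: (mulIf (expf_neq0 e z0)); rewrite -exprD me Fp_fermat //.
by rewrite mulVf // expf_neq0.
Qed.

Lemma bin2_double (m : nat) : ('C(m.*2, 2) + m)%N = (m.*2 * m)%N.
Proof. by rewrite bin2; case: m => //= m; lia. Qed.
Lemma bin2_doubleS (m : nat) : 'C(m.*2.+1, 2) = (m.*2.+1 * m)%N.
Proof. by rewrite bin2 /=; lia. Qed.

Lemma Fp_four (p : nat) : prime p -> odd p -> 4 ^+ p.-1./2 = 1 :> 'F_p.
Proof.
move=> pp op; have [two0 _ _ _] := double_eqN1_facts _ _ (Fp_double_half p pp op).
rewrite (_ : 4 = 2 ^+ 2 :> 'F_p) -?exprM ?mul2n; last by ring.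
by rewrite (_ : _.*2 = p.-1) ?Fp_fermat //; have := prime_gt0 pp; lia.
Qed.

(** Here ['C(n, 2) = n m - m], so the determinant is [- (-1)^m c^-m = - d^-m], which equals [d^m]
    because [d^(2m) = -1]. *)
Lemma Fp_det1_1mod4 (p m : nat) (d : int) :
  prime p -> (p.-1./2 = m.*2)%N -> odd p ->
  (- d)%:~R ^+ p.-1./2 = -1 :> 'F_p ->
  Fp_det p 1 (- d)%:~R = d%:~R ^+ m.
Proof.
move=> pp pm op cn.
have n_gt0 : (0 < p.-1./2)%N by have := odd_prime_gt2 op pp; lia.
rewrite /Fp_det det_unity_diff1 //; first last.
- exact: Fp_four.
- exact: Fp_double_half.
- by move=> j; apply: Fp_sq_unity.
- exact: Fp_sq_inj.
have c0 : (- d)%:~R != 0 :> 'F_p.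
  apply/eqP => z; move/eqP: cn.
  by rewrite z expr0n gtn_eqF //= eq_sym oppr_eq0 oner_eq0.
have d2 : (d%:~R ^+ 2) ^+ m = -1 :> 'F_p.
  by rewrite -sqrrN -mulrNz -exprM mul2n -pm.
apply: (mulIf (expf_neq0 m c0)).
rewrite mulNr -exprD pm bin2_double exprM -pm cn -exprMn mulrNz mulrN -expr2.
by rewrite (exprNn (_ ^+ 2)) d2 mulrN1.
Qed.

Lemma Fp_det1_3mod4 (p m : nat) (c : 'F_p) :
  prime p -> (p.-1./2 = m.*2.+1)%N -> odd p -> c ^+ p.-1./2 = -1 ->
  Fp_det p 1 c = (-1) ^+ m.+1.
Proof.
move=> pp pm op cn; have n_gt0 : (0 < p.-1./2)%N by rewrite pm.
rewrite /Fp_det det_unity_diff1 //; first last.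
- exact: Fp_four.
- exact: Fp_double_half.
- by move=> j; apply: Fp_sq_unity.
- exact: Fp_sq_inj.
by rewrite pm bin2_doubleS exprM -pm cn exprS mulN1r.
Qed.

Lemma Fp_det2_1mod4 (p m : nat) (c : 'F_p) :
  prime p -> (p.-1./2 = m.*2)%N -> odd p -> c ^+ p.-1./2 = -1 ->
  Fp_det p 2 c = 0.
Proof.
move=> pp pm op cn.
have n_gt0 : (0 < p.-1./2)%N by have := odd_prime_gt2 op pp; lia.
rewrite /Fp_det det_unity_diff2 //; first last.
- exact: Fp_four.
- exact: Fp_double_half.
- by move=> j; apply: Fp_sq_unity.
- exact: Fp_sq_inj.
by rewrite (prod_quarter_eq0 _ _ m) ?mulr0 //; apply: Fp_double_half.
Qed.

(** As [n] is odd, [(-1)^(n+1) = 1], and [c^(n m) = (-1)^m] cancels the sign from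
    [prod_quarter_sym]. *)
Lemma Fp_det2_3mod4 (p m : nat) (c : 'F_p) :
  prime p -> (p.-1./2 = m.*2.+1)%N -> odd p -> c ^+ p.-1./2 = -1 ->
  Fp_det p 2 c = 4^-1 * \prod_(1 <= r < m.+1) (r%:R + 4^-1) ^+ 2.
Proof.
move=> pp pm op cn; have n_gt0 : (0 < p.-1./2)%N by rewrite pm.
rewrite /Fp_det det_unity_diff2 //; first last.
- exact: Fp_four.
- exact: Fp_double_half.
- by move=> j; apply: Fp_sq_unity.
- exact: Fp_sq_inj.
have n2 := Fp_double_half p pp op.
rewrite pm in n2 cn *.
rewrite prod_quarter_sym // bin2_doubleS exprM cn.
by rewrite -mulrA signrMK -doubleS -mul2n exprM sqrrN !expr1n mul1r.
Qed.

(** * The two residue classes of [p] modulo 4 *)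

Theorem theorem1p2 (p : nat) (d : int) :
  prime p -> odd p -> legendre p (- d) = -1 ->
  ( legendre p (Smdet (p - 2) d p) = legendre p 2
    /\ ((p %% 4 = 1)%N ->
          rat_eqmod p (Tinv 1 d p) ((d%:~R : rat) ^+ ((p - 1) %/ 4)))
    /\ ((p %% 4 = 3)%N ->
          rat_eqmod p (Tinv 1 d p) ((-1 : rat) ^+ ((p + 1) %/ 4))) )
  /\
  ( 2 * legendre p (Smdet (p - 3) d p) = 1 - legendre p (-1)
    /\ ((p %% 4 = 3)%N ->
          rat_eqmod p (Tinv 2 d p)
            (4^-1 * \prod_(1 <= r < ((p - 3) %/ 4).+1) ((r%:R + 4^-1) ^+ 2)))).
Proof.
move=> pp op leg_d; have p_gt2 := odd_prime_gt2 op pp.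
have cn : (- d)%:~R ^+ p.-1./2 = -1 :> 'F_p.
  by rewrite -legendre_Fp // leg_d mulrNz.
have n2 := Fp_double_half p pp op.
have [two0 four0 _ _] := double_eqN1_facts _ _ n2.
have two_n : 2 ^+ p.-1./2 = (-1) ^+ uphalf p.-1./2 :> 'F_p.
  apply: euler_two => //; rewrite fact_prod natr_prod prodf_seq_neq0.
  apply/allP => i; rewrite mem_index_iota => /andP[i_gt0 i_le] /=.
  by apply: Fp_nat_neq0 => //; lia.
have S1 := Smdet_Fp p (p - 2) 1 d pp op cn ltac:(lia).
have S2 := Smdet_Fp p (p - 3) 2 d pp op cn ltac:(lia).
have T1 := Tinv_reduces p 1 d pp op cn.
have T2 := Tinv_reduces p 2 d pp op cn.
set m := p.-1./2./2; case o : (odd p.-1./2).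
- have pm : p.-1./2 = m.*2.+1 by lia.
  rewrite (_ : (p + 1) %/ 4 = m.+1)%N; last by lia.
  rewrite (_ : (p - 3) %/ 4 = m)%N; last by lia.
  rewrite (Fp_det1_3mod4 p m) // in S1 T1.
  rewrite (Fp_det2_3mod4 p m) // in S2 T2.
  (* Here [p = 4m + 3], and four times the element is [4(i+1) + 1], which is less than [p]. *)
  have quarter0 (i : nat) : (i < m)%N -> i.+1%:R + 4^-1 != 0 :> 'F_p.
    move=> im; apply/eqP => /(congr1 ( *%R 4)) /eqP.
    rewrite mulrDr mulfV // mulr0 -natrM natr1; apply/negP.
    by apply: Fp_nat_neq0 => //; lia.
  split; split.
  (* The exponent [n] is odd, so both sides reduce to [(-1)^(m+1)]. *)
  + apply: (legendre_eq p) => //; rewrite S1 two_n -exprM pm.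
    rewrite (_ : uphalf _ = m.+1); last by lia.
    rewrite -[LHS]signr_odd -[RHS]signr_odd; by rewrite oddM /= odd_double andbT.
  + split=> p4; first by exfalso; lia.
    apply: (reduces_eqmod _ _ _ _ pp T1); apply: reduces_exp.
    exact: (reduces_int p (-1)).
  + have -> : legendre p (-1) = -1.
      rewrite -[RHS]leg_d; apply: legendre_eq => //.
      by rewrite cn mulrNz pm exprS -mul2n exprM sqrrN !expr1n mulr1.
    have -> : legendre p (Smdet (p - 3) d p) = 1; last by [].
    rewrite -[RHS](legendre_1 p pp); apply: legendre_eq => //.
    rewrite S2 expr1n prodrXl.
    (* The determinant is thus a nonzero square [w^2], and [w^(2n) = w^(p-1) = 1]. *)
    rewrite {1}(_ : 4^-1 = 2^-1 ^+ 2 :> 'F_p); last by field; rewrite two0 four0.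
    rewrite -exprMn -exprM (_ : (2 * _)%N = p.-1); last by lia.
    apply: Fp_fermat => //; rewrite mulf_neq0 ?invr_eq0 // big_add1 /=.
    rewrite prodf_seq_neq0; apply/allP => i.
    by rewrite mem_index_iota => /andP[_] /quarter0 ->.
  + move=> p4; apply: (reduces_eqmod _ _ _ _ pp T2); apply: reducesM.
      by apply: reducesV => //; apply: (reduces_int p 4).
    apply: reduces_prod => r _; apply: reduces_exp; apply: reducesD.
      exact: (reduces_int p r).
    by apply: reducesV => //; apply: (reduces_int p 4).
- have pm : p.-1./2 = m.*2 by lia.
  rewrite (_ : (p - 1) %/ 4 = m)%N; last by lia.
  rewrite (Fp_det1_1mod4 p m) // in S1 T1.
  rewrite (Fp_det2_1mod4 p m) // in S2 T2.
  split; split.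
  (* Both sides are [(-1)^m]: the left one is [(d^m)^n = (d^n)^m], and [d^n = (-d)^n = -1] as [n] is
     even. *)
  + apply: (legendre_eq p) => //; rewrite S1 two_n -exprM.
    have dn : d%:~R ^+ p.-1./2 = -1 :> 'F_p.
      by rewrite -cn pm -mul2n !exprM mulrNz sqrrN.
    by rewrite mulnC exprM dn pm uphalf_double.
  + split=> p4; last by exfalso; lia.
    apply: (reduces_eqmod _ _ _ _ pp T1); apply: reduces_exp.
    exact: reduces_int.
  + have -> : legendre p (-1) = 1.
      rewrite -[RHS](legendre_1 p pp); apply: legendre_eq => //.
      by rewrite mulrNz mulr1z pm -mul2n exprM sqrrN !expr1n.
    have -> : legendre p (Smdet (p - 3) d p) = 0; last by [].
    rewrite -(legendre_0 p); apply: legendre_eq => //.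
    by rewrite S2.
  + by move=> p4; exfalso; lia.
Qed.
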